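(* Let $R$ be a ring with unit and $M$ an $R$-bimodule. Let $\mathrm{Struct}[R,M]$ denote the set of cohomology classes of structures on $(R,M)$. Then there is a bijection $$\mathrm{Struct}[R,M]\to H^3_{MacL}(R,M),\qquad [h=(\xi,\eta,\alpha,\lambda,\rho)]\mapsto[\widehat h=(\sigma,\alpha,\lambda,\rho)],$$ where $\sigma(x,y,z,t)=\xi(x+y,z,t)-\xi(x,y,z)+\eta(y,z)+\xi(x,z,y)-\xi(x+z,y,t)$.
   Context: **Structures.** A structure on $(R,M)$ (the constraints of an Ann-category of type $(R,M)$) is a 5-tuple $h=(\xi,\eta,\alpha,\lambda,\rho)$ of functions $\xi,\alpha,\lambda,\rho:R^3\to M$, $\eta:R^2\to M$ such that for all $x,y,z,t\in R$: (A1) $\xi(y,z,t)-\xi(x+y,z,t)+\xi(x,y+z,t)-\xi(x,y,z+t)+\xi(x,y,z)=0$; (A2) $\xi(x,y,z)-\xi(x,z,y)+\xi(z,x,y)+\eta(x+y,z)-\eta(x,z)-\eta(y,z)=0$; (A3) $\eta(x,y)+\eta(y,x)=0$; (A4) $x\eta(y,z)-\eta(xy,xz)=\lambda(x,y,z)-\lambda(x,z,y)$; (A5) $\eta(x,y)z-\eta(xz,yz)=\rho(x,y,z)-\rho(y,x,z)$; (A6) $x\xi(y,z,t)-\xi(xy,xz,xt)=\lambda(x,z,t)-\lambda(x,y+z,t)+\lambda(x,y,z+t)-\lambda(x,y,z)$; (A7) $\xi(x,y,z)t-\xi(xt,yt,zt)=\rho(y,z,t)-\rho(x+y,z,t)+\rho(x,y+z,t)-\rho(x,y,t)$;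 (A8) $\rho(x,y,z+t)-\rho(x,y,z)-\rho(x,y,t)+\lambda(x,z,t)+\lambda(y,z,t)-\lambda(x+y,z,t)=-\xi(xz+xt,yz,yt)+\xi(xz,xt,yz)-\eta(xt,yz)+\xi(xz+yz,xt,yt)-\xi(xz,yz,xt)$; (A9) $\alpha(x,y,z+t)-\alpha(x,y,z)-\alpha(x,y,t)=x\lambda(y,z,t)+\lambda(x,yz,yt)-\lambda(xy,z,t)$; (A10) $\alpha(x,y+z,t)-\alpha(x,y,t)-\alpha(x,z,t)=x\rho(y,z,t)-\rho(xy,xz,t)+\lambda(x,yt,zt)-\lambda(x,y,z)t$; (A11) $\alpha(x+y,z,t)-\alpha(x,z,t)-\alpha(y,z,t)=-\rho(x,y,z)t-\rho(xz,yz,t)+\rho(x,y,zt)$; (A12) $x\alpha(y,z,t)-\alpha(xy,z,t)+\alpha(x,yz,t)-\alpha(x,y,zt)+\alpha(x,y,z)t=0$; and the normalization conditions: $\xi,\alpha,\lambda,\rho$ vanish when any argument is $0$, except that for $\rho$ only the conditions $\rho(0,y,z)=\rho(x,0,z)=\rho(x,y,0)=0$ and for $\lambda$ only $\lambda(0,y,z)=\lambda(x,0,z)=\lambda(x,y,0)=0$ are meant (i.e. each of the three arguments); $\alpha$ vanishes when any argument is $1$; $\lambda(1,y,z)=0$; $\rho(x,y,1)=0$. Two structures $h=(\xi,\eta,\alpha,\lambda,\rho)$ and $h'=(\xi',\eta',\alpha',\lambda',\rho')$ are cohomologous if there are functions $\tau,\nu:R^2\to M$ with $\tau(0,y)=\tau(x,0)=0$,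 $\nu(0,y)=\nu(x,0)=\nu(1,y)=\nu(x,1)=0$ and (A13) $\xi(x,y,z)-\xi'(x,y,z)=\tau(y,z)-\tau(x+y,z)+\tau(x,y+z)-\tau(x,y)$; (A14) $\eta(x,y)-\eta'(x,y)=\tau(x,y)-\tau(y,x)$; (A15) $\alpha(x,y,z)-\alpha'(x,y,z)=x\nu(y,z)-\nu(xy,z)+\nu(x,yz)-\nu(x,y)z$; (A16) $\lambda(x,y,z)-\lambda'(x,y,z)=\nu(x,y+z)-\nu(x,y)-\nu(x,z)+x\tau(y,z)-\tau(xy,xz)$; (A17) $\rho(x,y,z)-\rho'(x,y,z)=\nu(x+y,z)-\nu(x,z)-\nu(y,z)+\tau(x,y)z-\tau(xz,yz)$. Cohomology classes of structures are the classes for this equivalence relation. **Mac Lane cohomology.** $Z^3_{MacL}(R,M)$ is the group of quadruples $(\sigma,\alpha,\lambda,\rho)$, $\sigma:R^4\to M$, $\alpha,\lambda,\rho:R^3\to M$, satisfying (M1) $x\alpha(y,z,t)-\alpha(xy,z,t)+\alpha(x,yz,t)-\alpha(x,y,zt)+\alpha(x,y,z)t=0$; (M2) $-\alpha(x,z,t)-\alpha(y,z,t)+\alpha(x+y,z,t)+\rho(xz,yz,t)-\rho(x,y,zt)+\rho(x,y,z)t=0$; (M3) $-\alpha(x,y,t)-\alpha(x,z,t)+\alpha(x,y+z,t)-x\rho(y,z,t)+\rho(xy,xz,t)-\lambda(x,yt,zt)+\lambda(x,y,z)t=0$; (M4) $\alpha(x,y,z)+\alpha(x,y,t)-\alpha(x,y,z+t)+x\lambda(y,z,t)-\lambda(xy,z,t)+\lambda(x,yz,yt)=0$;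 (M5) $-\lambda(x,z,t)-\lambda(y,z,t)+\lambda(x+y,z,t)+\rho(x,y,z)+\rho(x,y,t)-\rho(x,y,z+t)+\sigma(xz,yz,xt,yt)=0$; (M6) $\lambda(r,x,y)+\lambda(r,z,t)-\lambda(r,x+z,y+t)-\lambda(r,x,z)-\lambda(r,y,t)+\lambda(r,x+y,z+t)-r\sigma(x,y,z,t)+\sigma(rx,ry,rz,rt)=0$; (M7) $-\rho(x,y,r)-\rho(z,t,r)+\rho(x+z,y+t,r)+\rho(x,z,r)+\rho(y,t,r)-\rho(x+y,z+t,r)-\sigma(xr,yr,zr,tr)+\sigma(x,y,z,t)r=0$; (M8) $-\sigma(r,s,u,v)-\sigma(x,y,z,t)+\sigma(r+x,s+y,u+z,v+t)+\sigma(r,s,x,y)+\sigma(u,v,z,t)-\sigma(r+u,s+v,x+z,y+t)-\sigma(r,u,x,z)-\sigma(s,v,y,t)+\sigma(r+s,u+v,x+y,z+t)=0$; and the normalization conditions: $\alpha,\lambda,\rho$ vanish when one argument is $0$; $\sigma(r,s,0,0)=\sigma(0,0,u,v)=\sigma(r,0,u,0)=\sigma(0,s,0,v)=\sigma(r,0,0,v)=0$. $B^3_{MacL}(R,M)$ is the subgroup of those quadruples in $Z^3_{MacL}(R,M)$ for which there are $\tau,\nu:R^2\to M$ with $\tau(0,y)=\tau(x,0)=0$, $\nu(0,y)=\nu(x,0)=\nu(1,y)=\nu(x,1)=0$ and (M9) $\sigma(x,y,z,t)=\tau(x,y)+\tau(z,t)-\tau(x+z,y+t)-\tau(x,z)-\tau(y,t)+\tau(x+y,z+t)$;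 (M10) $\alpha(x,y,z)=x\nu(y,z)-\nu(xy,z)+\nu(x,yz)-\nu(x,y)z$; (M11) $\lambda(x,y,z)=\nu(x,y+z)-\nu(x,y)-\nu(x,z)+x\tau(y,z)-\tau(xy,xz)$; (M12) $\rho(x,y,z)=\nu(x+y,z)-\nu(x,z)-\nu(y,z)+\tau(x,y)z-\tau(xz,yz)$. $H^3_{MacL}(R,M)=Z^3_{MacL}(R,M)/B^3_{MacL}(R,M)$.
   Formalization: Cocycles in Z^3_MacL are additionally required to have α vanish when any argument is 1; without this the map is not surjective (e.g. R=M=F_3, the coboundary of τ=0 and ν the indicator of (1,2) has λ(1,1,1)=1, while every ĥ and every element of B^3 has λ(1,1,1)=0). *)

(* Defs.v *)
From HB Require Import structures.
From mathcomp Require Import all_boot all_algebra.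
From mathcomp Require Import boolp.

Set Implicit Arguments.
Unset Strict Implicit.
Unset Printing Implicit Defensive.

Import GRing.Theory.
Local Open Scope ring_scope.
Local Open Scope quotient_scope.

(* R is an arbitrary unital ring: not necessarily commutative, possibly zero. *)
HB.mixin Record Lmodule_isBimodule (R : pzRingType) M of GRing.Lmodule R M := {
  rscale : M -> R -> M;
  rscaleDl : forall (v w : M) (a : R), rscale (v + w) a = rscale v a + rscale w a;
  rscaleDr : forall (v : M) (a b : R), rscale v (a + b) = rscale v a + rscale v b;
  rscaleA : forall (v : M) (a b : R), rscale (rscale v a) b = rscale v (a * b);
  rscale1 : forall v : M, rscale v 1 = v;
  scale_rscaleA : forall (a : R) (v : M) (b : R),
    rscale (a *: v) b = a *: rscale v b
}.

#[short(type="bimodType")]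
HB.structure Definition Bimodule (R : pzRingType) :=
  {M of GRing.Lmodule R M & Lmodule_isBimodule R M}.

Notation "v <* a" := (rscale v a) (at level 40, left associativity) : ring_scope.

Section BimoduleTheory.
Variables (R : pzRingType) (M : bimodType R).

Lemma rscale0 (a : R) : (0 : M) <* a = 0.
Proof. by apply: (addrI ((0 : M) <* a)); rewrite -rscaleDl !addr0. Qed.

Lemma rscaleN (v : M) (a : R) : (- v) <* a = - (v <* a).
Proof. by apply: (addrI (v <* a)); rewrite -rscaleDl !subrr rscale0. Qed.

End BimoduleTheory.

Section Cochains.
Variables (R : pzRingType) (M : bimodType R).

Definition normalized3 (f : R -> R -> R -> M) : Prop :=
  [/\ forall y z, f 0 y z = 0, forall x z, f x 0 z = 0 & forall x y, f x y 0 = 0].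

Definition unit_normalized3 (f : R -> R -> R -> M) : Prop :=
  [/\ forall y z, f 1 y z = 0, forall x z, f x 1 z = 0 & forall x y, f x y 1 = 0].

(* eta carries no normalization condition. *)
Record is_structure (xi : R -> R -> R -> M) (eta : R -> R -> M)
    (alpha lambda rho : R -> R -> R -> M) : Prop := IsStructure {
  structA1 : forall x y z t,
    xi y z t - xi (x + y) z t + xi x (y + z) t - xi x y (z + t) + xi x y z = 0;
  structA2 : forall x y z,
    xi x y z - xi x z y + xi z x y + eta (x + y) z - eta x z - eta y z = 0;
  structA3 : forall x y, eta x y + eta y x = 0;
  structA4 : forall x y z,
    x *: eta y z - eta (x * y) (x * z) = lambda x y z - lambda x z y;
  structA5 : forall x y z,
    eta x y <* z - eta (x * z) (y * z) = rho x y z - rho y x z;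
  structA6 : forall x y z t,
    x *: xi y z t - xi (x * y) (x * z) (x * t)
    = lambda x z t - lambda x (y + z) t + lambda x y (z + t) - lambda x y z;
  structA7 : forall x y z t,
    xi x y z <* t - xi (x * t) (y * t) (z * t)
    = rho y z t - rho (x + y) z t + rho x (y + z) t - rho x y t;
  structA8 : forall x y z t,
    rho x y (z + t) - rho x y z - rho x y t
      + lambda x z t + lambda y z t - lambda (x + y) z t
    = - xi (x * z + x * t) (y * z) (y * t) + xi (x * z) (x * t) (y * z)
      - eta (x * t) (y * z) + xi (x * z + y * z) (x * t) (y * t)
      - xi (x * z) (y * z) (x * t);
  structA9 : forall x y z t,
    alpha x y (z + t) - alpha x y z - alpha x y t
    = x *: lambda y z t + lambda x (y * z) (y * t) - lambda (x * y) z t;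
  structA10 : forall x y z t,
    alpha x (y + z) t - alpha x y t - alpha x z t
    = x *: rho y z t - rho (x * y) (x * z) t
      + lambda x (y * t) (z * t) - lambda x y z <* t;
  structA11 : forall x y z t,
    alpha (x + y) z t - alpha x z t - alpha y z t
    = - (rho x y z <* t) - rho (x * z) (y * z) t + rho x y (z * t);
  structA12 : forall x y z t,
    x *: alpha y z t - alpha (x * y) z t + alpha x (y * z) t
      - alpha x y (z * t) + alpha x y z <* t = 0;
  struct_xi0 : normalized3 xi;
  struct_alpha0 : normalized3 alpha;
  struct_lambda0 : normalized3 lambda;
  struct_rho0 : normalized3 rho;
  struct_alpha1 : unit_normalized3 alpha;
  struct_lambda1 : forall y z, lambda 1 y z = 0;
  struct_rho1 : forall x y, rho x y 1 = 0
}.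

Record structure : Type := Structure {
  xi : R -> R -> R -> M;
  eta : R -> R -> M;
  alpha : R -> R -> R -> M;
  lambda : R -> R -> R -> M;
  rho : R -> R -> R -> M;
  structureP : is_structure xi eta alpha lambda rho
}.

HB.instance Definition _ := gen_eqMixin structure.
HB.instance Definition _ := gen_choiceMixin structure.

Definition tau_normalized (tau : R -> R -> M) : Prop :=
  (forall y, tau 0 y = 0) /\ (forall x, tau x 0 = 0).

Definition nu_normalized (nu : R -> R -> M) : Prop :=
  [/\ forall y, nu 0 y = 0, forall x, nu x 0 = 0,
      forall y, nu 1 y = 0 & forall x, nu x 1 = 0].

Record cohomology (h h' : structure) (tau nu : R -> R -> M) : Prop := Cohomology {
  cohomology_tau : tau_normalized tau;
  cohomology_nu : nu_normalized nu;
  cohomologyA13 : forall x y z,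
    xi h x y z - xi h' x y z
    = tau y z - tau (x + y) z + tau x (y + z) - tau x y;
  cohomologyA14 : forall x y, eta h x y - eta h' x y = tau x y - tau y x;
  cohomologyA15 : forall x y z,
    alpha h x y z - alpha h' x y z
    = x *: nu y z - nu (x * y) z + nu x (y * z) - nu x y <* z;
  cohomologyA16 : forall x y z,
    lambda h x y z - lambda h' x y z
    = nu x (y + z) - nu x y - nu x z + x *: tau y z - tau (x * y) (x * z);
  cohomologyA17 : forall x y z,
    rho h x y z - rho h' x y z
    = nu (x + y) z - nu x z - nu y z + tau x y <* z - tau (x * z) (y * z)
}.

Definition cohomologous (h h' : structure) : Prop :=
  exists tau nu : R -> R -> M, cohomology h h' tau nu.

Record quadruple : Type := Quadruple {
  qsigma : R -> R -> R -> R -> M;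
  qalpha : R -> R -> R -> M;
  qlambda : R -> R -> R -> M;
  qrho : R -> R -> R -> M
}.

HB.instance Definition _ := gen_eqMixin quadruple.
HB.instance Definition _ := gen_choiceMixin quadruple.

Lemma quadruple_ext (c c' : quadruple) :
  (forall x y z t, qsigma c x y z t = qsigma c' x y z t) ->
  (forall x y z, qalpha c x y z = qalpha c' x y z) ->
  (forall x y z, qlambda c x y z = qlambda c' x y z) ->
  (forall x y z, qrho c x y z = qrho c' x y z) -> c = c'.
Proof.
case: c c' => [s a l r] [s' a' l' r'] /= es ea el er; congr Quadruple.
- by do 4![apply: funext => ?]; apply: es.
- by do 3![apply: funext => ?]; apply: ea.
- by do 3![apply: funext => ?]; apply: el.
- by do 3![apply: funext => ?]; apply: er.
Qed.

Definition quadruple0 : quadruple :=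
  Quadruple (fun _ _ _ _ => 0) (fun _ _ _ => 0) (fun _ _ _ => 0) (fun _ _ _ => 0).

Definition quadruple_opp (c : quadruple) : quadruple :=
  Quadruple (fun x y z t => - qsigma c x y z t) (fun x y z => - qalpha c x y z)
    (fun x y z => - qlambda c x y z) (fun x y z => - qrho c x y z).

Definition quadruple_add (c c' : quadruple) : quadruple :=
  Quadruple (fun x y z t => qsigma c x y z t + qsigma c' x y z t)
    (fun x y z => qalpha c x y z + qalpha c' x y z)
    (fun x y z => qlambda c x y z + qlambda c' x y z)
    (fun x y z => qrho c x y z + qrho c' x y z).

Lemma quadruple_addA : associative quadruple_add.
Proof. by move=> *; apply: quadruple_ext => * /=; rewrite addrA. Qed.

Lemma quadruple_addC : commutative quadruple_add.
Proof. by move=> *; apply: quadruple_ext => * /=; rewrite addrC. Qed.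

Lemma quadruple_add0 : left_id quadruple0 quadruple_add.
Proof. by move=> *; apply: quadruple_ext => * /=; rewrite add0r. Qed.

Lemma quadruple_addN : left_inverse quadruple0 quadruple_opp quadruple_add.
Proof. by move=> *; apply: quadruple_ext => * /=; rewrite addNr. Qed.

HB.instance Definition _ := GRing.isZmodule.Build quadruple
  quadruple_addA quadruple_addC quadruple_add0 quadruple_addN.

(* The vanishing of alpha when one argument is 1 is part of the normalization, *)
(* in accordance with the conditions nu(1,y) = nu(x,1) = 0 on coboundaries:     *)
(* those make alpha(1,y,z) an invariant of the cohomology class, so that the    *)
(* classes of structures could not exhaust a cohomology group whose cocycles    *)
(* are normalized only at 0.  lambda(1,y,z) = 0 and rho(x,y,1) = 0 then follow  *)
(* from macM4 and macM2.                                                        *)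
Record mac_lane_cocycle (sigma : R -> R -> R -> R -> M)
    (alpha lambda rho : R -> R -> R -> M) : Prop := MacLaneCocycle {
  macM1 : forall x y z t,
    x *: alpha y z t - alpha (x * y) z t + alpha x (y * z) t
      - alpha x y (z * t) + alpha x y z <* t = 0;
  macM2 : forall x y z t,
    - alpha x z t - alpha y z t + alpha (x + y) z t
      + rho (x * z) (y * z) t - rho x y (z * t) + rho x y z <* t = 0;
  macM3 : forall x y z t,
    - alpha x y t - alpha x z t + alpha x (y + z) t
      - x *: rho y z t + rho (x * y) (x * z) t
      - lambda x (y * t) (z * t) + lambda x y z <* t = 0;
  macM4 : forall x y z t,
    alpha x y z + alpha x y t - alpha x y (z + t)
      + x *: lambda y z t - lambda (x * y) z t + lambda x (y * z) (y * t) = 0;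
  macM5 : forall x y z t,
    - lambda x z t - lambda y z t + lambda (x + y) z t
      + rho x y z + rho x y t - rho x y (z + t)
      + sigma (x * z) (y * z) (x * t) (y * t) = 0;
  macM6 : forall r x y z t,
    lambda r x y + lambda r z t - lambda r (x + z) (y + t)
      - lambda r x z - lambda r y t + lambda r (x + y) (z + t)
      - r *: sigma x y z t + sigma (r * x) (r * y) (r * z) (r * t) = 0;
  macM7 : forall r x y z t,
    - rho x y r - rho z t r + rho (x + z) (y + t) r
      + rho x z r + rho y t r - rho (x + y) (z + t) r
      - sigma (x * r) (y * r) (z * r) (t * r) + sigma x y z t <* r = 0;
  macM8 : forall r s u v x y z t,
    - sigma r s u v - sigma x y z t + sigma (r + x) (s + y) (u + z) (v + t)
      + sigma r s x y + sigma u v z t - sigma (r + u) (s + v) (x + z) (y + t)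
      - sigma r u x z - sigma s v y t
      + sigma (r + s) (u + v) (x + y) (z + t) = 0;
  mac_alpha0 : normalized3 alpha;
  mac_lambda0 : normalized3 lambda;
  mac_rho0 : normalized3 rho;
  mac_alpha1 : unit_normalized3 alpha;
  mac_sigma0 :
    [/\ forall r s, sigma r s 0 0 = 0, forall u v, sigma 0 0 u v = 0,
        forall r u, sigma r 0 u 0 = 0, forall s v, sigma 0 s 0 v = 0
      & forall r v, sigma r 0 0 v = 0]
}.

Definition Z3MacL_pred : {pred quadruple} :=
  fun c => `[< mac_lane_cocycle (qsigma c) (qalpha c) (qlambda c) (qrho c) >].

Record mac_lane_coboundary (sigma : R -> R -> R -> R -> M)
    (alpha lambda rho : R -> R -> R -> M) (tau nu : R -> R -> M) : Prop :=
  MacLaneCoboundary {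
  cobound_tau : tau_normalized tau;
  cobound_nu : nu_normalized nu;
  coboundM9 : forall x y z t,
    sigma x y z t
    = tau x y + tau z t - tau (x + z) (y + t) - tau x z - tau y t
      + tau (x + y) (z + t);
  coboundM10 : forall x y z,
    alpha x y z = x *: nu y z - nu (x * y) z + nu x (y * z) - nu x y <* z;
  coboundM11 : forall x y z,
    lambda x y z
    = nu x (y + z) - nu x y - nu x z + x *: tau y z - tau (x * y) (x * z);
  coboundM12 : forall x y z,
    rho x y z
    = nu (x + y) z - nu x z - nu y z + tau x y <* z - tau (x * z) (y * z)
}.

(* Pointwise differences are pulled to the root of a linear expression.       *)
Lemma subDsub (V : zmodType) (a b c d : V) : (a - b) + (c - d) = (a + c) - (b + d).
Proof. by rewrite opprD addrACA. Qed.

Lemma opp_sub (V : zmodType) (a b : V) : - (a - b) = - a - - b.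
Proof. exact: opprD. Qed.

Lemma rscaleB (v w : M) (a : R) : (v - w) <* a = v <* a - w <* a.
Proof. by rewrite rscaleDl rscaleN. Qed.

Let push_opp := (rscaleB, scalerBr, opp_sub).

Lemma Z3MacL_zmod_closed : zmod_closed Z3MacL_pred.
Proof.
split=> [|[s a l r] [s' a' l' r'] /asboolP /= c /asboolP /= c']; apply/asboolP.
  by split=> *; try split=> *; rewrite ?scaler0 ?rscale0 ?oppr0 ?addr0.
change (mac_lane_cocycle (fun x y z t => s x y z t - s' x y z t)
  (fun x y z => a x y z - a' x y z) (fun x y z => l x y z - l' x y z)
  (fun x y z => r x y z - r' x y z)).
case: c => c1 c2 c3 c4 c5 c6 c7 c8 [a1 a2 a3] [l1 l2 l3] [r1 r2 r3] [u1 u2 u3]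
  [s1 s2 s3 s4 s5].
case: c' => d1 d2 d3 d4 d5 d6 d7 d8 [b1 b2 b3] [m1 m2 m3] [q1 q2 q3] [v1 v2 v3]
  [t1 t2 t3 t4 t5].
split=> *; try split=> *; rewrite ?push_opp ?subDsub.
- by rewrite c1 d1 subrr.
- by rewrite c2 d2 subrr.
- by rewrite c3 d3 subrr.
- by rewrite c4 d4 subrr.
- by rewrite c5 d5 subrr.
- by rewrite c6 d6 subrr.
- by rewrite c7 d7 subrr.
- by rewrite c8 d8 subrr.
- by rewrite a1 b1 subrr.
- by rewrite a2 b2 subrr.
- by rewrite a3 b3 subrr.
- by rewrite l1 m1 subrr.
- by rewrite l2 m2 subrr.
- by rewrite l3 m3 subrr.
- by rewrite r1 q1 subrr.
- by rewrite r2 q2 subrr.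
- by rewrite r3 q3 subrr.
- by rewrite u1 v1 subrr.
- by rewrite u2 v2 subrr.
- by rewrite u3 v3 subrr.
- by rewrite s1 t1 subrr.
- by rewrite s2 t2 subrr.
- by rewrite s3 t3 subrr.
- by rewrite s4 t4 subrr.
- by rewrite s5 t5 subrr.
Qed.

HB.instance Definition _ :=
  GRing.isZmodClosed.Build quadruple Z3MacL_pred Z3MacL_zmod_closed.

Record Z3MacL : Type := Z3MacLElt {
  Z3MacL_val :> quadruple;
  Z3MacL_valP : Z3MacL_val \in Z3MacL_pred
}.

HB.instance Definition _ := [isSub for Z3MacL_val].
HB.instance Definition _ := [Choice of Z3MacL by <:].
HB.instance Definition _ := [SubChoice_isSubZmodule of Z3MacL by <:].

Definition B3MacL : {pred Z3MacL} :=
  fun c => `[< exists tau nu : R -> R -> M,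
    mac_lane_coboundary (qsigma c) (qalpha c) (qlambda c) (qrho c) tau nu >].

Lemma B3MacL_zmod_closed : zmod_closed B3MacL.
Proof.
split=> [|[[s a l r] ?] [[s' a' l' r'] ?]].
  apply/asboolP; exists (fun _ _ => 0), (fun _ _ => 0); split=> *; try split=> *;
  by rewrite ?scaler0 ?rscale0 ?oppr0 ?addr0.
move=> /asboolP /= [tau [nu [[t1 t2] [n1 n2 n3 n4] c9 c10 c11 c12]]].
move=> /asboolP /= [tau' [nu' [[u1 u2] [m1 m2 m3 m4] d9 d10 d11 d12]]].
apply/asboolP.
exists (fun x y => tau x y - tau' x y), (fun x y => nu x y - nu' x y).
change (mac_lane_coboundary (fun x y z t => s x y z t - s' x y z t)
  (fun x y z => a x y z - a' x y z) (fun x y z => l x y z - l' x y z)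
  (fun x y z => r x y z - r' x y z) (fun x y => tau x y - tau' x y)
  (fun x y => nu x y - nu' x y)).
split=> *; try split=> *; rewrite ?push_opp ?subDsub.
- by rewrite t1 u1 subrr.
- by rewrite t2 u2 subrr.
- by rewrite n1 m1 subrr.
- by rewrite n2 m2 subrr.
- by rewrite n3 m3 subrr.
- by rewrite n4 m4 subrr.
- by rewrite c9 d9.
- by rewrite c10 d10.
- by rewrite c11 d11.
- by rewrite c12 d12.
Qed.

HB.instance Definition _ :=
  GRing.isZmodClosed.Build Z3MacL B3MacL B3MacL_zmod_closed.

Definition H3MacL : zmodType := Quotient.quot B3MacL.

Lemma cohomologous_equiv :
  equiv_class_of (fun h h' : structure => `[< cohomologous h h' >]).
Proof.
have half h h' : cohomologous h h' -> cohomologous h' h.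
  case=> tau [nu [[t1 t2] [n1 n2 n3 n4] c13 c14 c15 c16 c17]].
  exists (fun x y => 0 - tau x y), (fun x y => 0 - nu x y).
  split=> *; try split=> *; rewrite ?push_opp ?subDsub ?scaler0 ?rscale0 ?oppr0 ?addr0.
  - by rewrite t1 subrr.
  - by rewrite t2 subrr.
  - by rewrite n1 subrr.
  - by rewrite n2 subrr.
  - by rewrite n3 subrr.
  - by rewrite n4 subrr.
  - by rewrite -c13 add0r opprB.
  - by rewrite -c14 add0r opprB.
  - by rewrite -c15 add0r opprB.
  - by rewrite -c16 add0r opprB.
  - by rewrite -c17 add0r opprB.
split=> [h|h h'|h2 h1 h3].
- apply/asboolP; exists (fun _ _ => 0), (fun _ _ => 0).
  by split=> *; try split=> *; rewrite ?subrr ?scaler0 ?rscale0 ?oppr0 ?addr0.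
- by apply/asboolP/asboolP; apply: half.
move=> /asboolP [tau [nu [[t1 t2] [n1 n2 n3 n4] c13 c14 c15 c16 c17]]].
move=> /asboolP /half [tau' [nu' [[u1 u2] [m1 m2 m3 m4] d13 d14 d15 d16 d17]]].
apply/asboolP.
exists (fun x y => tau x y - tau' x y), (fun x y => nu x y - nu' x y).
split=> *; try split=> *; rewrite ?push_opp ?subDsub.
- by rewrite t1 u1 subrr.
- by rewrite t2 u2 subrr.
- by rewrite n1 m1 subrr.
- by rewrite n2 m2 subrr.
- by rewrite n3 m3 subrr.
- by rewrite n4 m4 subrr.
- by rewrite -c13 -d13 opprB addrA subrK.
- by rewrite -c14 -d14 opprB addrA subrK.
- by rewrite -c15 -d15 opprB addrA subrK.
- by rewrite -c16 -d16 opprB addrA subrK.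
- by rewrite -c17 -d17 opprB addrA subrK.
Qed.

Definition cohomology_equiv : equiv_rel structure := EquivRelPack cohomologous_equiv.

Definition Struct : Type := {eq_quot cohomology_equiv}.

HB.instance Definition _ := EqQuotient.on Struct.

Definition hat_sigma (h : structure) (x y z t : R) : M :=
  xi h (x + y) z t - xi h x y z + eta h y z + xi h x z y - xi h (x + z) y t.

Definition hat (h : structure) : quadruple :=
  Quadruple (hat_sigma h) (alpha h) (lambda h) (rho h).

End Cochains.

Arguments Struct : clear implicits.
Arguments Z3MacL : clear implicits.
Arguments B3MacL : clear implicits.
Arguments H3MacL : clear implicits.
Arguments structure : clear implicits.
Arguments quadruple : clear implicits.

(* Main.v *)
(* The interchange sigma(x,y,z,t) is the canonical comparison of (x+y)+(z+t)
   with (x+z)+(y+t) in a symmetric categorical group with associativity xi and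
   commutativity eta.  A symmetric monoidal functor (f, phi) preserves it up to
   the coboundary (M9) of phi.  For the functors r *: _, _ <* r and the
   addition from the square of the categorical group, this gives (M6), (M7) and
   (M8); in the last case phi = - sigma, and sigma is compatible with xi and eta
   by (A1)-(A3).  For the identity with phi = tau, it sends cohomologous
   structures to cohomologous cocycles.  Conversely, sigma determines
   xi(x,y,z) = sigma(x,0,y,z) and eta(x,y) = sigma(0,x,y,0), and (M8) shows that
   every cocycle arises from the structure so defined. *)
Require Import Defs.
From HB Require Import structures.
From mathcomp Require Import all_boot all_algebra.
From mathcomp Require Import boolp.

Set Implicit Arguments.
Unset Strict Implicit.
Unset Printing Implicit Defensive.

Import GRing.Theory.
Local Open Scope ring_scope.
Local Open Scope quotient_scope.

(** * Linear identities in abelian groups *)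

Inductive zexpr : Type :=
  | ZAtom of nat | ZZero | ZOpp of zexpr | ZAdd of zexpr & zexpr.

Fixpoint zeval (V : zmodType) (s : seq V) (e : zexpr) : V :=
  match e with
  | ZAtom i => s`_i
  | ZZero => 0
  | ZOpp e1 => - zeval s e1
  | ZAdd e1 e2 => zeval s e1 + zeval s e2
  end.

Fixpoint zcoef (e : zexpr) (i : nat) : int :=
  match e with
  | ZAtom j => (i == j)%:Z
  | ZZero => 0
  | ZOpp e1 => - zcoef e1 i
  | ZAdd e1 e2 => zcoef e1 i + zcoef e2 i
  end.

Fixpoint zbound (e : zexpr) : nat :=
  match e with
  | ZAtom j => j.+1
  | ZZero => 0
  | ZOpp e1 => zbound e1
  | ZAdd e1 e2 => maxn (zbound e1) (zbound e2)
  end.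

Lemma zevalE (V : zmodType) (s : seq V) (e : zexpr) (n : nat) :
  (zbound e <= n)%N -> zeval s e = \sum_(i < n) s`_i *~ zcoef e i.
Proof.
elim: e => [j|//|e IHe|e1 IH1 e2 IH2] /=.
- move=> ltjn; rewrite (bigD1 (Ordinal ltjn)) //= eqxx big1 ?addr0 // => i.
  by rewrite -val_eqE /= => /negPf ->.
- by rewrite big1.
- by move=> /IHe ->; rewrite -sumrN; apply: eq_bigr => i _; rewrite mulrNz.
rewrite geq_max => /andP[/IH1 -> /IH2 ->]; rewrite -big_split.
by apply: eq_bigr => i _; rewrite mulrzDr.
Qed.

(** Soundness of [zmodule]: an integer combination of atoms vanishes once all its coefficients do,
    and these are found by computation. *)
Lemma zeval_eq0 (V : zmodType) (s : seq V) (e : zexpr) :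
  all (fun i => zcoef e i == 0) (iota 0 (zbound e)) -> zeval s e = 0.
Proof.
move=> /allP e0; rewrite (zevalE s (leqnn _)) big1 // => i _.
by rewrite (eqP (e0 i _)) ?mulr0z // mem_iota ltn_ord.
Qed.

(** Reduces [a = b] to a formal check, with [c = d] a signed sum of known identities. *)
Lemma linear_combination (V : zmodType) (a b c d : V) :
  c = d -> a - b - (c - d) = 0 -> a = b.
Proof. by move=> ->; rewrite subrr subr0 => /subr0_eq. Qed.

Lemma eqrD (V : zmodType) (a b c d : V) : a = b -> c = d -> a + c = b + d.
Proof. by move=> -> ->. Qed.

Lemma eqrB (V : zmodType) (a b c d : V) : a = b -> c = d -> a - c = b - d.
Proof. by move=> -> ->. Qed.

Local Notation "p [+] q" := (eqrD p q) (at level 50, left associativity).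
Local Notation "p [-] q" := (eqrB p q) (at level 50, left associativity).

(* Atoms are compared up to conversion: the same sum in R may occur with
   different, convertible structure instances. *)
Ltac zatom_index a s :=
  match s with
  | ?b :: _ =>
      let _ := match goal with _ => unify a b end in constr:(0%N)
  | _ :: ?s' => let n := zatom_index a s' in constr:(n.+1)
  end.

Ltac zatoms t s :=
  lazymatch t with
  | 0 => s
  | - ?a => zatoms a s
  | ?a + ?b => let s' := zatoms a s in zatoms b s'
  | _ =>
      match s with
      | _ => let _ := zatom_index t s in s
      | _ => constr:(t :: s)
      end
  end.

Ltac zreify t s :=
  lazymatch t with
  | 0 => constr:(ZZero)
  | - ?a => let e := zreify a s in constr:(ZOpp e)
  | ?a + ?b =>
      let e1 := zreify a s in let e2 := zreify b s in constr:(ZAdd e1 e2)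
  | _ => let n := zatom_index t s in constr:(ZAtom n)
  end.

Ltac zmodule :=
  lazymatch goal with
  | |- @eq ?V ?t 0 =>
      let s := zatoms t constr:(@nil V) in
      let e := zreify t s in
      change (zeval s e = 0);
      apply: zeval_eq0; vm_compute; reflexivity
  | |- _ => apply: subr0_eq; zmodule
  end.

(** * The interchange of a symmetric 3-cocycle *)

Section Interchange.

Variable M : zmodType.

Definition interchange {A : nmodType} (xi : A -> A -> A -> M)
    (eta : A -> A -> M) (x y z t : A) : M :=
  xi (x + y) z t - xi x y z + eta y z + xi x z y - xi (x + z) y t.

Lemma interchange_functor (A B : nmodType)
    (xi1 : A -> A -> A -> M) (eta1 : A -> A -> M)
    (xi2 : B -> B -> B -> M) (eta2 : B -> B -> M)
    (f : A -> B) (phi : A -> A -> M) :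
  {morph f : x y / x + y} ->
  (forall x y z, xi1 x y z - xi2 (f x) (f y) (f z)
    = phi y z - phi (x + y) z + phi x (y + z) - phi x y) ->
  (forall x y, eta1 x y - eta2 (f x) (f y) = phi x y - phi y x) ->
  forall x y z t,
  interchange xi1 eta1 x y z t - interchange xi2 eta2 (f x) (f y) (f z) (f t)
  = phi x y + phi z t - phi (x + z) (y + t) - phi x z - phi y t
    + phi (x + y) (z + t).
Proof.
move=> fD Hxi Heta x y z t; rewrite /interchange -!fD.
have := Hxi (x + y) z t [-] Hxi x y z [+] Heta y z [+] Hxi x z y
  [-] Hxi (x + z) y t.
move=> H; apply: (linear_combination H).
(* Values of [phi] are atoms for [zmodule], so equal sums in [A] must first be written alike. *)
rewrite (addrC z y) (addrAC x z y); zmodule.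
Qed.

Variables (A : nmodType) (xi : A -> A -> A -> M) (eta : A -> A -> M).

Hypothesis xi_cocycle : forall x y z t,
  xi y z t - xi (x + y) z t + xi x (y + z) t - xi x y (z + t) + xi x y z = 0.
Hypothesis xi_eta : forall x y z,
  xi x y z - xi x z y + xi z x y + eta (x + y) z - eta x z - eta y z = 0.
Hypothesis eta_anti : forall x y, eta x y + eta y x = 0.

(* The combinations of (A1)-(A3) in the next two proofs were found by a computer
   search. *)
Lemma interchange_swap x y z t :
  interchange xi eta x y z t - interchange xi eta z t x y
  = eta (x + y) (z + t) - eta x z - eta y t.
Proof.
have H := xi_cocycle z x y t [-] xi_eta x y t [-] xi_eta x y z
  [+] eta_anti (x + y) t [-] eta_anti x t [+] xi_eta z t (x + y)
  [+] eta_anti (x + y) z [-] xi_cocycle z x t y [+] xi_cocycle z t x y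
  [-] eta_anti (x + y) (z + t).
apply: (linear_combination H); rewrite /interchange.
rewrite ?(addrC t y) ?(addrC t x) ?(addrC z x); zmodule.
Qed.

Lemma interchange_assoc x y z x' y' z' :
  xi (x + x') (y + y') (z + z') - xi x y z - xi x' y' z'
  = interchange xi eta y y' z z' - interchange xi eta (x + y) (x' + y') z z'
    + interchange xi eta x x' (y + z) (y' + z') - interchange xi eta x x' y y'.
Proof.
have H := xi_cocycle (x + x') y y' z [-] xi_cocycle (x + x') (y + y') z z'
  [-] xi_eta (x + y) (x' + y') z [-] xi_cocycle (x + y + z) x' y' z'
  [-] xi_cocycle z (x + y) x' y' [+] xi_eta (x + y + x') y' z
  [+] xi_cocycle (x + x') (y + z) y' z' [+] xi_eta (x + y) x' z
  [-] eta_anti (y + z) x' [-] xi_cocycle (x + x') y z y' [+] eta_anti z x'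
  [+] xi_eta (x + y) z x' [-] xi_eta x (y + z) x' [-] xi_cocycle x' x y z
  [+] xi_eta x y x' [+] eta_anti y x'.
apply: (linear_combination H); rewrite /interchange.
rewrite !(@addrA A) (addrC z x) (addrAC x z y) (addrC x' x).
rewrite !(addrAC _ z x') !(addrAC _ y x') !(addrAC _ z y').
rewrite (addrC z y').
zmodule.
Qed.

Lemma interchange_interchange r s u v x y z t :
  - interchange xi eta r s u v - interchange xi eta x y z t
    + interchange xi eta (r + x) (s + y) (u + z) (v + t)
    + interchange xi eta r s x y + interchange xi eta u v z t
    - interchange xi eta (r + u) (s + v) (x + z) (y + t)
    - interchange xi eta r u x z - interchange xi eta s v y t
    + interchange xi eta (r + s) (u + v) (x + y) (z + t) = 0.
Proof.
(* The functor is addition from [A * A] with componentwise [xi] and [eta]; [interchange_assoc] and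
   [interchange_swap] provide its two compatibility conditions. *)
have := @interchange_functor (A * A)%type A
  (fun p q w => xi p.1 q.1 w.1 + xi p.2 q.2 w.2)
  (fun p q => eta p.1 q.1 + eta p.2 q.2) xi eta (fun p => p.1 + p.2)
  (fun p q => - interchange xi eta p.1 p.2 q.1 q.2).
move=> /(_ _ _ _ (r, s) (u, v) (x, y) (z, t)) H.
apply: (linear_combination (esym (H _ _ _))) => [p q|p q w|p q|] /=.
- exact: addrACA.
- apply: (linear_combination
    (esym (interchange_assoc p.1 q.1 w.1 p.2 q.2 w.2))); zmodule.
- apply: (linear_combination (interchange_swap p.1 p.2 q.1 q.2)).
  zmodule.
rewrite /interchange /=; zmodule.
Qed.

End Interchange.

(** * From structures to Mac Lane cocycles *)

Section MacLane.

Variables (R : pzRingType) (M : bimodType R).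
Implicit Types h : structure R M.

(** At [(0, 0, x)] every [xi] term of (A2) vanishes and only [- eta 0 x] remains. *)
Lemma eta0x (xi : R -> R -> R -> M) (eta : R -> R -> M) :
  (forall x y z,
    xi x y z - xi x z y + xi z x y + eta (x + y) z - eta x z - eta y z = 0) ->
  normalized3 xi -> forall x, eta 0 x = 0.
Proof.
move=> A2 [xil xim xir] x; have := A2 0 0 x.
rewrite add0r !xil xir => H.
apply: (linear_combination (esym H)); zmodule.
Qed.

Lemma etax0 (xi : R -> R -> R -> M) (eta : R -> R -> M) :
  (forall x y z,
    xi x y z - xi x z y + xi z x y + eta (x + y) z - eta x z - eta y z = 0) ->
  (forall x y, eta x y + eta y x = 0) ->
  normalized3 xi -> forall x, eta x 0 = 0.
Proof.
by move=> A2 A3 xi0 x; have := A3 x 0; rewrite (eta0x A2 xi0) addr0.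
Qed.

Lemma hat_sigma_xi h x y z : hat_sigma h x 0 y z = xi h x y z.
Proof.
rewrite /hat_sigma; case: (structureP h) => _ A2 _ _ _ _ _ _ _ _ _ _ xi0.
by case: (xi0) => _ xim xir *; rewrite addr0 !xim xir (eta0x A2 xi0); zmodule.
Qed.

Lemma hat_sigma_eta h x y : hat_sigma h 0 x y 0 = Defs.eta h x y.
Proof.
rewrite /hat_sigma; case: (structureP h) => _ _ _ _ _ _ _ _ _ _ _ _.
by case=> xil _ xir *; rewrite !xil !xir; zmodule.
Qed.

Lemma hat_cocycle h :
  mac_lane_cocycle (hat_sigma h) (alpha h) (lambda h) (rho h).
Proof.
case: h => xi eta alpha lambda rho hP; rewrite /hat_sigma /=.
case: hP => A1 A2 A3 A4 A5 A6 A7 A8 A9 A10 A11 A12 xi0 alpha0 lambda0 rho0.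
move=> alpha1 lambda1 rho1; case: (xi0) => xi0l xi0m xi0r.
have eta0l := eta0x A2 xi0; have eta0r := etax0 A2 A3 xi0.
split=> //.
- by move=> x y z t; apply: (linear_combination (A11 x y z t)); zmodule.
- by move=> x y z t; apply: (linear_combination (A10 x y z t)); zmodule.
- by move=> x y z t; apply: (linear_combination (esym (A9 x y z t))); zmodule.
- move=> x y z t.
  (* (A8) contains [eta (x * t) (y * z)], while [sigma] contains the value with the arguments
     exchanged; (A3) relates the two. *)
  apply: (linear_combination (esym (A8 x y z t) [+] A3 (x * t) (y * z))).
  zmodule.
- move=> r x y z t.
  (* Left multiplication by [r] is monoidal with [phi] equal to [lambda r]: its two conditions are
     (A6) and (A4). *)
  have H := @interchange_functor M R R (fun x y z => r *: xi x y z)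
    (fun x y => r *: eta x y) xi eta (fun x => r * x) (lambda r) (mulrDr r)
    (A6 r) (A4 r) x y z t.
  apply: (linear_combination (esym H)); rewrite /interchange.
  by rewrite !(scalerDr, scalerN); zmodule.
- move=> r x y z t.
  have H := @interchange_functor M R R (fun x y z => xi x y z <* r)
    (fun x y => eta x y <* r) xi eta (fun x => x * r)
    (fun x y => rho x y r) (fun x y => mulrDl x y r)
    (fun x y z => A7 x y z r) (fun x y => A5 x y r) x y z t.
  apply: (linear_combination H); rewrite /interchange.
  by rewrite !(rscaleDl, rscaleN); zmodule.
- exact: interchange_interchange.
- by split=> *; rewrite ?(xi0l, xi0m, xi0r, eta0l, eta0r, addr0, add0r, oppr0).
Qed.

(** * From Mac Lane cocycles to structures *)

Section Unhat.

Variables (sigma : R -> R -> R -> R -> M) (alpha lambda rho : R -> R -> R -> M).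
Hypothesis cP : mac_lane_cocycle sigma alpha lambda rho.

Definition unhat_xi (x y z : R) : M := sigma x 0 y z.
Definition unhat_eta (x y : R) : M := sigma 0 x y 0.

Lemma interchange_unhat x y z t :
  interchange unhat_xi unhat_eta x y z t = sigma x y z t.
Proof.
case: cP => _ _ _ _ _ _ _ M8 _ _ _ _ [s1 s2 s3 s4 s5].
rewrite /interchange /unhat_xi /unhat_eta.
(* The second instance of (M8) reduces [sigma x y z t] to [sigma x y z 0], which the first expresses
   through [unhat_xi] and [unhat_eta]. *)
have H := M8 x 0 0 0 0 y z 0 [+] M8 x 0 y 0 z 0 0 t.
apply: (linear_combination (esym H)).
rewrite ?(addr0, add0r, s1, s2, s3, s4, s5).
zmodule.
Qed.

(** Zeros placed in (M8) give (A1) to (A3), in (M6) they give (A4) and (A6), in (M7) they give (A5)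
    and (A7). With (A3), [interchange_unhat] turns (M5) into (A8). *)
Lemma unhat_structure :
  is_structure unhat_xi unhat_eta alpha lambda rho.
Proof.
have sigmaE := interchange_unhat.
case: (cP) => M1 M2 M3 M4 M5 M6 M7 M8 alpha0 lambda0 rho0 alpha1.
move=> [s1 s2 s3 s4 s5]; have s0 := (s1, s2, s3, s4, s5, addr0, add0r).
case: (lambda0) => _ l2 l3; case: (rho0) => r1 r2 _.
have A3 x y : sigma 0 x y 0 + sigma 0 y x 0 = 0.
  have H := M8 0 0 x 0 0 y 0 0.
  apply: (linear_combination H).
  rewrite !s0; zmodule.
split=> //.
- move=> x y z t; rewrite /unhat_xi.
  apply: (linear_combination (esym (M8 x 0 0 0 y 0 z t))).
  rewrite !s0; zmodule.
- move=> x y z; rewrite /unhat_xi /unhat_eta.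
  apply: (linear_combination (M8 0 0 x 0 z 0 0 y [+] M8 0 x 0 0 0 y z 0)).
  rewrite !s0; zmodule.
- move=> x y z; rewrite /unhat_eta.
  apply: (linear_combination (esym (M6 x 0 y z 0))).
  rewrite !s0 !mulr0 !l2 !l3; zmodule.
- move=> x y z; rewrite /unhat_eta.
  apply: (linear_combination (M7 z 0 x y 0)).
  rewrite !s0 !mul0r !r1 !r2; zmodule.
- move=> x y z t; rewrite /unhat_xi.
  apply: (linear_combination (esym (M6 x y 0 z t))).
  rewrite !s0 !mulr0 !l2 !l3; zmodule.
- move=> x y z t; rewrite /unhat_xi.
  apply: (linear_combination (M7 t x 0 y z)).
  rewrite !s0 !mul0r !r1 !r2; zmodule.
- move=> x y z t.
  have := M5 x y z t; rewrite -sigmaE /interchange => H.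
  apply: (linear_combination (esym H [+] A3 (x * t) (y * z))).
  zmodule.
- by move=> x y z t; apply: (linear_combination (esym (M4 x y z t))); zmodule.
- by move=> x y z t; apply: (linear_combination (M3 x y z t)); zmodule.
- by move=> x y z t; apply: (linear_combination (M2 x y z t)); zmodule.
- case: alpha1 => a1 _ _ y z.
  (* At two units the [alpha] terms vanish and two of the three [lambda] terms cancel, leaving
     [lambda 1 y z]. *)
  apply: (linear_combination (M4 1 1 y z)).
  rewrite !mul1r scale1r !a1; zmodule.
- case: alpha1 => _ a2 _ x y.
  apply: (linear_combination (M2 x y 1 1)).
  rewrite !mulr1 rscale1 !a2; zmodule.
Qed.

End Unhat.

(** * Comparison of cohomology classes *)

Definition hatZ h : Z3MacL R M :=
  @Z3MacLElt R M (hat h) (introT (asboolP _) (hat_cocycle h)).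

Definition unhat (c : Z3MacL R M) : structure R M :=
  Structure (unhat_structure (elimT (asboolP _) (Z3MacL_valP c))).

Lemma unhatK : cancel unhat hatZ.
Proof.
move=> c; apply: val_inj; apply: quadruple_ext => //= x y z t.
exact: (interchange_unhat (elimT (asboolP _) (Z3MacL_valP c))).
Qed.

(** The two directions make the map on classes injective and well defined. *)
Lemma cohomologous_hat h h' :
  (hatZ h - hatZ h' \in B3MacL R M) = `[< cohomologous h h' >].
Proof.
apply: asbool_equiv_eq; split=> -[tau [nu]].
(* By normalization of [tau], (M9) at [(x, 0, y, z)] and [(0, x, y, 0)] is (A13) and (A14). *)
- case=> -[tau0x taux0] ? M9 *; exists tau, nu; split=> // [x y z|x y].
  + rewrite -!hat_sigma_xi; apply: (etrans (M9 x 0 y z)).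
    by rewrite !(taux0, tau0x, addr0, add0r); zmodule.
  + rewrite -!hat_sigma_eta; apply: (etrans (M9 0 x y 0)).
    by rewrite !(taux0, tau0x, addr0, add0r); zmodule.
case=> ? ? A13 A14 *; exists tau, nu; split=> // x y z t.
exact: (@interchange_functor M R R _ _ _ _ id).
Qed.

End MacLane.

Theorem proposition12 (R : pzRingType) (M : bimodType R) :
  exists f : Struct R M -> H3MacL R M,
    bijective f /\
    forall h : structure R M,
      exists2 c : Z3MacL R M,
        c = hat h :> quadruple R M & f (\pi_(Struct R M) h) = \pi_(H3MacL R M) c.
Proof.
have piE h h' : (\pi_(H3MacL R M) (hatZ h) == \pi_(H3MacL R M) (hatZ h'))
    = (\pi_(Struct R M) h == \pi_(Struct R M) h').
  by rewrite -Quotient.idealrBE cohomologous_hat eqmodE.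
pose f (s : Struct R M) := \pi_(H3MacL R M) (hatZ (repr s)).
have f_pi h : f (\pi_(Struct R M) h) = \pi_(H3MacL R M) (hatZ h).
  by apply/eqP; rewrite piE reprK.
exists f; split=> [|h]; last by exists (hatZ h).
(* The inverse applies [unhat] to a representing cocycle; [piE] and [unhatK] yield the cancellation
   on structures. *)
exists (fun c => \pi_(Struct R M) (unhat (repr c))) => [s|c].
  by rewrite -[RHS]reprK; apply/eqP; rewrite -piE unhatK reprK.
by rewrite f_pi unhatK reprK.
Qed.
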